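(* Assume the following (supported-clique amplification): for every integer $r\ge 3$, if there exists a triangle-free graph $G$ with $\tau_{K_r}(G)<\infty$, then there exists a triangle-free graph $G'$ such that Builder can force two compatible supported copies of $K_r$ from $G'$. Then for every integer $k\ge 3$ there exists a triangle-free graph from which Builder can force $K_k$. Consequently, $$\rho(k)<\infty \qquad\text{and}\qquad s(k)<\infty$$ for all $k\ge 3$.
   Context: All graphs are finite and simple. A matching is a set of pairwise vertex-disjoint edges; $V(M)$ denotes the set of endpoints of the edges of $M$. Degree-preserving Builder--Chooser game started from a graph $G_0$: it is played in rounds $t=1,2,\dots$. In round $t$ the current graph is $G_{t-1}=(V,E)$. (i) Builder chooses a matching $M\subseteq E$ and forms the intermediate graph $G^+$ by deleting the edges of $M$, adding a new vertex $w$, and joining $w$ to every vertex of $V(M)$ (a DPG step). (ii) Builder chooses a partition of $E(G^+)$ into two disjoint sets $E^{(0)}\sqcup E^{(1)}$. (iii) Chooser selects $i\in\{0,1\}$, and $G_t:=(V(G^+),E^{(i)})$. For graphs $H$ and $G_0$, the forcing time $\tau_H(G_0)$ is the least $T\ge 0$ such that Builder has a strategy in the game started from $G_0$ guaranteeing that $G_t$ contains $H$ as a (not necessarily induced) subgraph for some $0\le t\le T$; $\tau_H(G_0)=\infty$ if there is no such $T$, i.e. if Chooser can avoid $H$ forever. ''Builder can force $K_k$ from $G$'' means $\tau_{K_k}(G)<\infty$. Similarly, Builder can force two compatible supported copies of $K_r$ from $G'$ if, for some finite $T$, Builder has a strategy in the game started from $G'$ guaranteeing that some $G_t$ with $0\le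 t\le T$ contains two compatible supported copies of $K_r$. A supported copy of $F$ in a graph $G$ is a pair $(F',S)$ where $F'$ is a subgraph of $G$ isomorphic to $F$, and $S$ is a matching in $G$ consisting of $|V(F')|$ edges, each having exactly one endpoint in $V(F')$ (so every vertex of $F'$ is incident with exactly one edge of $S$, whose other endpoint lies outside $V(F')$). Two supported copies $(F_1',S_1)$ and $(F_2',S_2)$ are compatible if $F_1'$ and $F_2'$ are vertex-disjoint and $S_1\cup S_2$ is a matching. For $k\ge 3$, $\rho(k):=\min\{\tau_{K_k}(G): G \text{ triangle-free},\ \tau_{K_k}(G)<\infty\}$ and $s(k):=\min\{|V(G)|: G \text{ triangle-free},\ \tau_{K_k}(G)<\infty\}$, each being $\infty$ if no such $G$ exists. *)

(* Defs.v *)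
From mathcomp Require Import all_boot.
From mathcomp Require Import boolp.

Set Implicit Arguments.
Unset Strict Implicit.
Unset Printing Implicit Defensive.

Record sgraph := SGraph {
  vertex :> finType;
  edges : {set {set vertex}};
  card_edge : forall e, e \in edges -> #|e| = 2 }.

Definition is_matching (G : sgraph) (M : {set {set G}}) : Prop :=
  M \subset edges G /\ trivIset M.

Lemma complete_card n (e : {set 'I_n}) :
  e \in [set e : {set 'I_n} | #|e| == 2] -> #|e| = 2.
Proof. by rewrite inE => /eqP. Qed.

Definition complete (n : nat) : sgraph := SGraph (@complete_card n).

(** The vertex set [W] and edge set [A] form a (not necessarily induced)
    subgraph of [G] isomorphic to [F]. *)
Definition is_copy (F G : sgraph) (W : {set G}) (A : {set {set G}}) : Prop :=
  A \subset edges G /\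
  exists f : F -> G,
    [/\ injective f, W = [set f x | x : F]
      & A = [set f @: e | e : {set F} in edges F]].

Definition contains (F G : sgraph) : Prop :=
  exists W A, @is_copy F G W A.

Definition triangle_free (G : sgraph) : Prop := ~ contains (complete 3) G.

Record supported_copy (F G : sgraph) := SupportedCopy {
  sc_vertices : {set G};
  sc_edges : {set {set G}};
  sc_matching : {set {set G}};
  sc_is_copy : @is_copy F G sc_vertices sc_edges;
  sc_is_matching : is_matching sc_matching;
  sc_card : #|sc_matching| = #|sc_vertices|;
  sc_endpoint : forall e, e \in sc_matching -> #|e :&: sc_vertices| = 1 }.

Definition compatible (F G : sgraph) (C1 C2 : supported_copy F G) : Prop :=
  [disjoint sc_vertices C1 & sc_vertices C2] /\
  is_matching (sc_matching C1 :|: sc_matching C2).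

Definition two_compatible_copies (F G : sgraph) : Prop :=
  exists C1 C2 : supported_copy F G, compatible C1 C2.

(** Edge set of the intermediate graph, on the vertex set [option G]; the new
    vertex is [None]. *)
Definition dpg_edges (G : sgraph) (M : {set {set G}}) : {set {set option G}} :=
  [set Some @: e | e : {set G} in edges G :\: M] :|:
  [set [set Some x; None] | x in cover M].

(** Either part may be empty. *)
Record move (G : sgraph) := Move {
  mv_matching : {set {set G}};
  mv_part0 : {set {set option G}};
  mv_part1 : {set {set option G}};
  mv_is_matching : is_matching mv_matching;
  mv_cover : mv_part0 :|: mv_part1 = dpg_edges mv_matching;
  mv_disjoint : [disjoint mv_part0 & mv_part1] }.

Definition mv_part (G : sgraph) (m : move G) (i : bool) : {set {set option G}} :=
  if i then mv_part1 m else mv_part0 m.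

Lemma mv_part_card (G : sgraph) (m : move G) (i : bool) e :
  e \in mv_part m i -> #|e| = 2.
Proof.
move=> ei; have: e \in dpg_edges (mv_matching m).
  by rewrite -mv_cover inE; move: ei; case: i => /= ->; rewrite ?orbT.
rewrite inE => /orP[/imsetP[d /setDP[dE _] ->]|/imsetP[x _ ->]].
  by rewrite card_imset ?(card_edge dE)//; apply: Some_inj.
by rewrite cards2.
Qed.

Definition next (G : sgraph) (m : move G) (i : bool) : sgraph :=
  SGraph (@mv_part_card G m i).

(** Builder's move may depend on the current graph and on the whole history.
    Since Builder is deterministic, the history is determined by the initial
    graph and Chooser's previous choices, listed here from first to last. *)
Definition strategy := seq bool -> forall G : sgraph, move G.

(** The graph after [t] rounds, when Chooser selects [c j] in round [j.+1]. *)
Fixpoint play (sigma : strategy) (c : nat -> bool) (G0 : sgraph) (t : nat)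
    : sgraph :=
  if t is j.+1 then
    let G := play sigma c G0 j in next (sigma (mkseq c j) G) (c j)
  else G0.

Definition forces_within (P : sgraph -> Prop) (G0 : sgraph) (T : nat) : Prop :=
  exists sigma : strategy, forall c : nat -> bool,
    exists2 t, t <= T & P (play sigma c G0 t).

Definition can_force (P : sgraph -> Prop) (G0 : sgraph) : Prop :=
  exists T, forces_within P G0 T.

(** Values in the naturals extended with infinity, encoded as [None]. *)
Definition enat := option nat.
Definition infty : enat := None.

Definition enat_min (P : nat -> Prop) : enat :=
  if pselect (exists n, `[< P n >]) is left ex then Some (ex_minn ex)
  else infty.

Definition forcing_time (H G0 : sgraph) : enat :=
  enat_min (forces_within (contains H) G0).

Definition rho (k : nat) : enat :=
  enat_min (fun n => exists G : sgraph,
    triangle_free G /\ forcing_time (complete k) G = Some n).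

Definition min_order (k : nat) : enat :=
  enat_min (fun n => exists G : sgraph,
    [/\ triangle_free G, forcing_time (complete k) G <> infty & #|G| = n]).

(* Main.v *)
(** If [G] contains two compatible supported copies of [K_r], Builder plays the
    union of the two supporting matchings: the new vertex becomes adjacent to
    both cliques, no clique edge is deleted, and the two resulting copies of
    [K_(r+1)] share only the new vertex, so that Builder can put their edges
    into different parts.  The same move starts the induction: in the
    4-cycle, deleting two opposite edges and joining the new vertex to all four
    vertices yields two edge-disjoint triangles. *)
Require Import Defs.
From mathcomp Require Import all_boot.
From mathcomp Require Import boolp.

Set Implicit Arguments.
Unset Strict Implicit.
Unset Printing Implicit Defensive.

Lemma imset_pair (aT rT : finType) (f : aT -> rT) (x y : aT) :
  f @: [set x; y] = [set f x; f y].
Proof. by rewrite imsetU1 imset_set1. Qed.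

(** Injectivity of [f] comes for free: if [f i = f j] with [i != j], the edge [[set f i; f j]] would
    be a singleton. *)
Lemma contains_completeP (n : nat) (G : sgraph) :
  contains (complete n) G <->
  exists f : 'I_n -> G, forall i j, i != j -> [set f i; f j] \in edges G.
Proof.
split=> [[W [A [AG [f [_ _ defA]]]]]|[f f_edge]].
  exists f => i j ij; apply: (subsetP AG); rewrite defA -imset_pair.
  by rewrite (imset_f (fun e : {set _} => f @: e))// inE cards2 ij.
exists [set f x | x : 'I_n], [set f @: e | e : {set 'I_n} in edges (complete n)].
split; last first.
  exists f; split=> // i j fij; apply/eqP; apply: contraT => ij.
  by have := card_edge (f_edge _ _ ij); rewrite fij setUid cards1.
apply/subsetP => _ /imsetP[e + ->].
rewrite inE => /cards2P[i [j [ij ->]]].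
by rewrite imset_pair f_edge.
Qed.

(** Part 0 receives the edges inside [K], the first clique with the new vertex; part 1 receives the
    rest. Every edge of the second enlarged clique has an endpoint outside [K], since the cliques
    are disjoint. *)
Lemma two_cliques_move (G : sgraph) (r : nat) (M : {set {set G}})
    (f : bool -> 'I_r -> G) :
  is_matching M ->
  (forall b i j, i != j -> [set f b i; f b j] \in edges G :\: M) ->
  (forall b i, f b i \in cover M) ->
  (forall i j, f false i != f true j) ->
  exists m : move G, forall b, contains (complete r.+1) (Defs.next m b).
Proof.
move=> matM f_edge f_cover f_neq.
pose D := dpg_edges M.
pose K := None |: [set Some (f false i) | i : 'I_r].
pose E0 := D :&: powerset K.
pose E1 := D :\: powerset K.
have E01 : [disjoint E0 & E1].
  by apply/pred0P => e; rewrite /= !inE; case: (e \subset K); rewrite ?andbF.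
exists (Move matM (setID _ _) E01) => b; apply/contains_completeP.
(* The last index goes to the new vertex [None], the others to the old clique. *)
exists (fun i => omap (f b) (unlift ord_max i)).
have inPart (e : {set option G}) :
    e \in D -> (~~ b -> e \subset K) ->
    (b -> exists i, Some (f true i) \in e) ->
    e \in (if b then E1 else E0).
  move=> eD; case: b => /= [_ /(_ isT)[i ie]|/(_ isT) eK _]; last first.
    by rewrite in_setI eD powersetE.
  rewrite in_setD eD andbT powersetE; apply/negP => /subsetP/(_ _ ie).
  rewrite !inE /= => /imsetP[j _ [/eqP]].
  by rewrite eq_sym (negPf (f_neq _ _)).
have SomeK i : ~~ b -> Some (f b i) \in K.
  by case: (b) => // _; rewrite inE imset_f ?orbT.
have NoneK : None \in K by rewrite !inE.
have old_new i : [set Some (f b i); None] \in (if b then E1 else E0).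
  apply: inPart => [|/SomeK iK|tb].
  - by apply/setUP; right; apply/imsetP; exists (f b i).
  - by rewrite subUset !sub1set iK.
  - by exists i; move: tb; case: (b) => // _; rewrite !inE eqxx.
have old_old i j : i != j ->
    [set Some (f b i); Some (f b j)] \in (if b then E1 else E0).
  move=> ij; apply: inPart => [|nb|tb].
  - apply/setUP; left; rewrite -imset_pair.
    by rewrite (imset_f (fun e : {set _} => Some @: e)) ?f_edge.
  - by rewrite subUset !sub1set !SomeK.
  - by exists i; move: tb; case: (b) => // _; rewrite !inE eqxx.
move=> i j; rewrite /Defs.next /mv_part /=.
case: unliftP => [i' ->|->]; case: unliftP => [j' ->|->] //=.
- by rewrite (inj_eq lift_inj); apply: old_old.
- by move=> _; rewrite setUC.
- by rewrite eqxx.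
Qed.

(** Double counting: the support edges are disjoint and each meets [W] in one vertex, so together
    they cover [#|S| = #|W|] vertices of [W], hence all of them. *)
Lemma supported_copy_cover (F G : sgraph) (C : supported_copy F G) :
  sc_vertices C \subset cover (sc_matching C).
Proof.
case: C => W A S _ [_ tS] /= cardS endS.
apply/setIidPr/eqP; rewrite eqEcard subsetIr -cardS /=.
rewrite -[X in _ <= X]sum1_card.
under eq_bigl do rewrite inE.
rewrite big_trivIset_cond//= -sum1_card leq_sum// => e eS.
rewrite -[X in X <= _](endS _ eS) -sum1_card.
by rewrite (eq_bigl _ _ (fun x => in_setI x e W)).
Qed.

(** The support edge at [x] has only one endpoint in the clique. If [[set x; y]] were in [M],
    disjointness would make it equal to that support edge, which would then have two. *)
Lemma supported_copy_edge (n : nat) (G : sgraph) (M : {set {set G}})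
    (C : supported_copy (complete n) G) (x y : G) :
  trivIset M -> sc_matching C \subset M ->
  x \in sc_vertices C -> y \in sc_vertices C -> x != y ->
  [set x; y] \notin M.
Proof.
move=> /trivIsetP tM /subsetP CM xC yC xy; apply/negP => xyM.
have /bigcupP[d dC xd] := subsetP (supported_copy_cover C) _ xC.
have dE : d = [set x; y].
  apply/eqP; apply: contraT => /(tM _ _ (CM _ dC) xyM).
  by move=> /pred0P/(_ x); rewrite /= xd set21.
have := sc_endpoint dC; rewrite dE (setIidPl _) ?cards2 ?xy//.
by rewrite subUset !sub1set xC.
Qed.

Lemma two_compatible_copies_move (n : nat) (G : sgraph) :
  two_compatible_copies (complete n) G ->
  exists m : move G, forall b, contains (complete n.+1) (Defs.next m b).
Proof.
move=> [C0 [C1 [C01 matM]]].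
set M := _ :|: _ in matM.
have copy (C : supported_copy (complete n) G) : sc_matching C \subset M ->
    exists f : 'I_n -> G,
      [/\ forall i, f i \in sc_vertices C, forall i, f i \in cover M
        & forall i j, i != j -> [set f i; f j] \in edges G :\: M].
  move=> CM; have [AG [f [f_inj WE AE]]] := sc_is_copy C.
  have fC i : f i \in sc_vertices C by rewrite WE imset_f.
  exists f; split=> // [i|i j ij].
    have /bigcupP[d dC fd] := subsetP (supported_copy_cover C) _ (fC i).
    by apply/bigcupP; exists d => //; apply: (subsetP CM).
  rewrite inE (supported_copy_edge matM.2 CM) ?inj_eq//=.
  apply: (subsetP AG); rewrite AE.
  rewrite -imset_pair (imset_f (fun e : {set _} => f @: e))//.
  by rewrite inE cards2 ij.
have [f0 [f0C f0M f0E]] := copy C0 (subsetUl _ _).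
have [f1 [f1C f1M f1E]] := copy C1 (subsetUr _ _).
apply: (@two_cliques_move G n M (fun b => if b then f1 else f0)) => //.
- by case.
- by case.
- move=> i j; apply: contraTneq (f1C j) => <-.
  by rewrite (disjointFr C01).
Qed.

(** Builder follows the strategy for [P] until [P] holds, then plays the move that yields [Q] for
    either choice: one extra round. *)
Lemma can_force_next (P Q : sgraph -> Prop) (G0 : sgraph) :
  (forall G, P G -> exists m : move G, forall b, Q (Defs.next m b)) ->
  can_force P G0 -> can_force Q G0.
Proof.
move=> /(_ _ _)/cid PQ [T [sigma sigmaP]].
pose sigma' : strategy := fun s G =>
  if pselect (P G) is left PG then sval (PQ G PG) else sigma s G.
exists T.+1, sigma' => c.
have [t0 t0T Pt0] := sigmaP c.
(* The first such time is needed: [sigma'] leaves [sigma] as soon as [P] holds, and the two plays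
   may differ afterwards. *)
have ex : exists t, `[< P (play sigma c G0 t) >] by exists t0; apply/asboolP.
case: (ex_minnP ex) => t /asboolP Pt min_t.
have same j : j <= t -> play sigma' c G0 j = play sigma c G0 j.
  elim: j => //= j IH jt; rewrite IH ?(ltnW jt)// /sigma'.
  case: pselect => // PG; have /asboolP/min_t := PG.
  by rewrite leqNgt jt.
exists t.+1; first by rewrite ltnS (leq_trans _ t0T)// min_t//; apply/asboolP.
rewrite /= same// /sigma'.
by case: pselect => // PG; case: (PQ _ PG).
Qed.

Lemma can_force_now (P : sgraph -> Prop) (G : sgraph) : P G -> can_force P G.
Proof.
have mat0 (H : sgraph) : is_matching (set0 : {set {set H}}).
  by split; [apply: sub0set | apply/trivIsetP => A B; rewrite inE].
have dis (H : sgraph) : [disjoint dpg_edges (set0 : {set {set H}}) & set0].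
  by rewrite -setI_eq0 setI0.
(* A strategy must be total, so an arbitrary legal move is supplied: empty matching, all edges in
   part 0. *)
move=> PG; exists 0, (fun _ H => Move (mat0 H) (setU0 _) (dis H)) => c.
by exists 0.
Qed.

(** These are the edges of the complete bipartite graph, the Boolean naming the side; for [T = bool]
    it is the 4-cycle. *)
Definition bipartite_edges (T : finType) : {set {set bool * T}} :=
  [set [set (false, p.1); (true, p.2)] | p : T * T].

Lemma bipartite_card (T : finType) (e : {set bool * T}) :
  e \in bipartite_edges T -> #|e| = 2.
Proof. by move=> /imsetP[p _ ->]; rewrite cards2. Qed.

Definition bipartite (T : finType) : sgraph := SGraph (@bipartite_card T).

Lemma bipartite_edge (T : finType) (x y : bipartite T) :
  [set x; y] \in edges (bipartite T) -> x.1 = ~~ y.1.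
Proof.
move=> xyE; have xy : x != y by have := card_edge xyE; rewrite cards2; case: eqP.
have /imsetP[p _ xyp] := xyE.
have := set21 x y; have := set22 x y; rewrite xyp !inE.
by case/orP=> /eqP yE; case/orP=> /eqP xE; move: xy; rewrite xE yE ?eqxx.
Qed.

Lemma triangle_free_bipartite (T : finType) : triangle_free (bipartite T).
Proof.
move=> /contains_completeP[f f_edge].
have f01 := bipartite_edge (f_edge (inord 0) (inord 1) _).
have f12 := bipartite_edge (f_edge (inord 1) (inord 2) _).
have f02 := bipartite_edge (f_edge (inord 0) (inord 2) _).
move: f01 f12 f02; rewrite -!(inj_eq val_inj) /= !inordK//.
by move=> /(_ isT)-> /(_ isT)-> /(_ isT); case: (f _).1.
Qed.

(** The two edges of the 4-cycle outside [M] serve as two disjoint copies of [K_2]. *)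
Lemma bipartite_triangle_move :
  exists m : move (bipartite bool), forall b, contains (complete 3) (Defs.next m b).
Proof.
pose M : {set {set bipartite bool}} :=
  [set [set (false, b); (true, ~~ b)] | b : bool].
apply: (@two_cliques_move _ 2 M (fun b i => (val i == 0, b))) => //.
- split.
    apply/subsetP => _ /imsetP[b _ ->].
    by apply/imsetP; exists (b, ~~ b).
  apply/trivIsetP => _ _ /imsetP[b _ ->] /imsetP[c _ ->].
  case: (eqVneq b c) => [->|bc _]; first by rewrite eqxx.
  apply/pred0P => -[x y] /=; rewrite !inE !xpair_eqE.
  by move: bc; case: b; case: c; case: x; case: y.
- move=> b i j ij.
  have -> : [set (val i == 0, b); (val j == 0, b)] = [set (false, b); (true, b)].
    case: i j ij => [[|[|//]] ?] [[|[|//]] ?] //= _.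
    by rewrite setUC.
  rewrite inE; apply/andP; split; last by apply/imsetP; exists (b, b).
  apply/negP => /imsetP[c _ /setP E].
  have := E (false, b); have := E (true, b); rewrite !inE !xpair_eqE.
  by case: (b); case: c {E}.
- move=> b i; apply/bigcupP.
  (* The edge of [M] with index [c] contains [(false, c)] and [(true, ~~ c)], so the index is
     flipped exactly on the [true] side. *)
  exists [set (false, (val i == 0) (+) b); (true, ~~ ((val i == 0) (+) b))].
    by apply/imsetP; exists ((val i == 0) (+) b).
  by rewrite !inE !xpair_eqE; case: b; case: (val i == 0).
- by move=> i j; rewrite xpair_eqE andbF.
Qed.

Lemma enat_min_neq_infty (P : nat -> Prop) : enat_min P <> infty <-> exists n, P n.
Proof.
rewrite /enat_min; case: pselect => [ex|nex]; split=> //.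
- by move=> _; case: ex => n /asboolP; exists n.
- by case=> n Pn; case: nex; exists n; apply/asboolP.
Qed.

Theorem theorem7p6 :
  (forall r : nat, 3 <= r ->
     (exists G : sgraph,
        triangle_free G /\ forcing_time (complete r) G <> infty) ->
     exists G' : sgraph,
       triangle_free G' /\ can_force (two_compatible_copies (complete r)) G') ->
  (forall k : nat, 3 <= k ->
     exists G : sgraph,
       triangle_free G /\ forcing_time (complete k) G <> infty) /\
  (forall k : nat, 3 <= k -> rho k <> infty /\ min_order k <> infty).
Proof.
move=> amplify.
have main k : 3 <= k -> exists G : sgraph,
    triangle_free G /\ forcing_time (complete k) G <> infty.
  elim: k => // k IH; rewrite leq_eqVlt => /predU1P[[<-]|k3].
    exists (bipartite bool); split; first exact: triangle_free_bipartite.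
    apply/enat_min_neq_infty.
    (* Being the starting graph holds at time 0, so the triangle appears after one round. *)
    apply: (@can_force_next (eq (bipartite bool))); last exact: can_force_now.
    by move=> _ <-; apply: bipartite_triangle_move.
  have [G [Gfree Gforce]] := amplify k k3 (IH k3).
  exists G; split=> //; apply/enat_min_neq_infty.
  by apply: can_force_next Gforce; apply: two_compatible_copies_move.
split=> // k /main[G [Gfree Gtime]].
split; apply/enat_min_neq_infty; last by exists #|G|, G.
case E: (forcing_time (complete k) G) Gtime => [n|] // _.
by exists n, G.
Qed.
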